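(* For every real number $\alpha<1$ there exists a closed parisian set $E\subset\mathbb{T}$ such that $\dim_H(E)\geq\alpha$.
   Context: The circle $\mathbb{T}=\mathbb{R}/2\mathbb{Z}$ is identified with $(-1,1]$. For a finite complex Borel measure $\mu$ on $\mathbb{T}$, its Fourier coefficients are $\widehat{\mu}(n)=\frac12\int e^{i\pi n x}\,d\mu(x)$, $n\in\mathbb{Z}$, and $\mathrm{supp}(\widehat{\mu})=\{n\in\mathbb{Z}:\widehat{\mu}(n)\neq 0\}$. A set $\Lambda\subset\mathbb{Z}$ is called a Rajchman set if for every finite complex Borel measure $\mu$ on $\mathbb{T}$: whenever $\widehat{\mu}(n)\to 0$ as $|n|\to\infty$, $n\in\mathbb{Z}\setminus\Lambda$, then also $\widehat{\mu}(n)\to 0$ as $|n|\to\infty$, $n\in\Lambda$. $M(E)$ denotes the set of finite complex Borel measures on $\mathbb{T}$ supported on $E$. A closed set $E\subset\mathbb{T}$ is called a parisian set if for every $\mu\in M(E)$ that is not absolutely continuous with respect to Lebesgue measure, $\mathrm{supp}(\widehat{\mu})$ is not a Rajchman set. $\dim_H$ denotes Hausdorff dimension. *)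

(* Defs.v *)
From HB Require Import structures.
From mathcomp Require Import all_boot all_order all_algebra.
From mathcomp Require Import complex.
From mathcomp Require Import all_classical all_reals all_analysis.

Set Implicit Arguments.
Unset Strict Implicit.
Unset Printing Implicit Defensive.

Import Order.TTheory GRing.Theory Num.Theory.
Import numFieldNormedType.Exports.

Local Open Scope classical_set_scope.
Local Open Scope ring_scope.
Local Open Scope complex_scope.

Section circle.
Variable R : realType.
Implicit Types E U : set R.

(* The circle R/2Z, represented by its fundamental domain (-1, 1]. Its Borel
   sets are the Borel subsets of R contained in (-1, 1]. *)
Definition circle : set R := `]-1, 1]%classic.

(* E is closed for the quotient topology of R/2Z iff its 2-periodic extension
   is closed in R; the topology induced by R on (-1, 1] would be the wrong
   one. *)
Definition circle_closed E : Prop :=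
  E `<=` circle /\ closed [set x : R | exists k : int, E (x + 2 * k%:~R)].

Definition circle_dist (x y : R) : R :=
  inf [set `|x - y + 2 * k%:~R| | k in [set: int]].

(* The maximum with 0 makes the diameter of the empty set 0, not -oo. *)
Definition circle_diam U : \bar R :=
  maxe 0%E (ereal_sup [set (circle_dist x y)%:E | x in U & y in U]).

Definition hausdorff_premeasure (s delta : R) E : \bar R :=
  ereal_inf [set (\sum_(0 <= k <oo) poweR (circle_diam (F k)) s)%E |
    F in [set F : nat -> set R |
      [/\ forall k, F k `<=` circle,
          forall k, (circle_diam (F k) <= delta%:E)%E
        & E `<=` \bigcup_k F k]]].

Definition hausdorff_measure (s : R) E : \bar R :=
  ereal_sup [set hausdorff_premeasure s delta E |
    delta in [set delta : R | 0 < delta]].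

(* Only s > 0 is considered: this does not change the infimum and avoids the
   convention 0 `^ 0 = 1, which is not the one wanted for empty sets in a
   cover. *)
Definition hausdorff_dim E : \bar R :=
  ereal_inf [set s%:E |
    s in [set s : R | 0 < s /\ hausdorff_measure s E = 0%E]].

End circle.

Section complex_measure.
Variable R : realType.
Local Notation bR := (measurableTypeR R).

(* A finite complex Borel measure on R, A |-> cre A + i * cim A, given by its
   real and imaginary parts, which are finite signed measures. Measures on the
   circle are those supported on (-1, 1] in the sense of [supported_on]. *)
Record complex_measure := ComplexMeasure {
  cre : {charge set bR -> \bar R} ;
  cim : {charge set bR -> \bar R} }.

Implicit Types (nu : {charge set bR -> \bar R}) (mu : complex_measure).

(* M(E): every Borel set disjoint from E has measure 0. *)
Definition supported_on (E : set R) mu : Prop :=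
  (cre mu).-null_set (~` E) /\ (cim mu).-null_set (~` E).

Definition abs_continuous mu : Prop :=
  cre mu `<< @lebesgue_measure R /\ cim mu `<< @lebesgue_measure R.

(* Integral against nu = nu^+ - nu^-, the Jordan decomposition. The latter does
   not depend on the Hahn decomposition chosen here. *)
Definition charge_integral nu (f : R -> R) : R :=
  let nuPN := projT2 (cid (projT2 (cid (Hahn_decomposition nu)))) in
  (\int[jordan_pos nuPN]_x f x) - (\int[jordan_neg nuPN]_x f x).

Definition cintegral mu (f : R -> R[i]) : R[i] :=
  let re x := complex.Re (f x) in
  let im x := complex.Im (f x) in
  (charge_integral (cre mu) re - charge_integral (cim mu) im) +i*
  (charge_integral (cre mu) im + charge_integral (cim mu) re).

Definition expi (t : R) : R[i] := cos t +i* sin t.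

Definition fourier_coef mu (n : int) : R[i] :=
  2^-1 * cintegral mu (fun x => expi (pi * n%:~R * x)).

Definition fourier_supp mu : set int := [set n | fourier_coef mu n != 0].

(* a n --> 0 as |n| --> oo with n in S; vacuous when S is finite. *)
Definition vanishes_along (S : set int) (a : int -> R[i]) : Prop :=
  forall e : R, 0 < e -> exists N : nat,
    forall n : int, S n -> (N <= `|n|)%N -> `|a n| < e%:C.

Definition rajchman (L : set int) : Prop :=
  forall mu, supported_on (@circle R) mu ->
    vanishes_along (~` L) (fourier_coef mu) ->
    vanishes_along L (fourier_coef mu).

Definition parisian (E : set R) : Prop :=
  circle_closed E /\
  forall mu, supported_on E mu -> ~ abs_continuous mu ->
    ~ rajchman (fourier_supp mu).

End complex_measure.

(* Main.v *)
Require Import Defs.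
From mathcomp Require Import all_boot all_order all_algebra.
From mathcomp Require Import complex.
From mathcomp Require Import all_classical all_reals all_analysis.
From mathcomp Require Import measurable_realfun.
From mathcomp Require Import ring lra zify.

(** The sets are E_q = {x : sin (pi q^n x) >= 0 for all n}, with q = 2b and b a
    power of 2. In terms of the digits of x / 2 in base 2b they are essentially
    the Cantor sets of the numbers all of whose digits are less than b.

    E_q is parisian because it carries no nonzero measure whose Fourier
    coefficients tend to 0. If mu in M(E_q) has a spectrum that is a Rajchman
    set, then the Rajchman property applied to mu itself shows that the
    coefficients of mu tend to 0: they vanish off the spectrum. Let nu be the
    real or the imaginary part of mu. For a trigonometric polynomial g, the
    products g(x) sin (pi m x) and g(x) cos (pi m x) then have nu-integrals
    tending to 0 as m grows ([trig_riemann_lebesgue]). The quadratic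
    P(t) = 3/4 - t/2 + t^2/2 satisfies
        P(sin u) = 1 - sin u / 2 - cos 2u / 4,   |P| <= 3/4 on [0, 1].
    By the first formula, inserting P(sin (pi q^n x)) in the integral of g does
    not change it in the limit; by the second one, it replaces the supremum of
    |g| on E_q by at most 3/4 of it. Iterating, the integral of g is 0
    ([diff_integral_eq0]). As E_q lies in [0, 1], half a period of the circle,
    where cos (pi x) is strictly monotone, polynomials in cos (pi x) converge
    boundedly to the indicators of rays, so nu = 0
    ([trig_determines_measure]).

    For the dimension, G(y) = sum_k floor(b^k y) / (2b)^k maps [0, 1) into E_q
    ([digit_map_avoiding]). If b^n (y' - y) >= 1, then the term of index n alone
    gives G(y') - G(y) >= (2b)^-n, so the inverse of G is s-Hoelder as soon as
    (2b)^s <= b ([digit_map_holder]). A cover of E_q thus pulls back to a cover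
    of [0, 1) by intervals of lengths at most 2b times the s-th powers of the
    diameters, and these lengths add up to at least 1: the s-dimensional measure
    of E_q is positive ([hausdorff_premeasure_avoiding]). For b = 2^j the
    condition reads s <= j / (j + 1), which is met by all s < alpha when j is
    large. *)

Set Implicit Arguments.
Unset Strict Implicit.
Unset Printing Implicit Defensive.

Import Order.TTheory GRing.Theory Num.Theory.
Import numFieldNormedType.Exports.

Local Open Scope classical_set_scope.
Local Open Scope ring_scope.

(** * Trigonometric polynomials *)

Section trigonometric_polynomials.
Variable R : realType.

Definition cosn (k : nat) (x : R) : R := cos (pi * k%:R * x).
Definition sinn (k : nat) (x : R) : R := sin (pi * k%:R * x).

(** Real trigonometric polynomials of period 2 as linear combinations of
    monomials, so that statements which are linear in the function are proved by
    induction; stability under products is a theorem ([trig_mul]). *)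
Inductive trig_poly : (R -> R) -> Prop :=
| trig_cos k : trig_poly (cosn k)
| trig_sin k : trig_poly (sinn k)
| trig_add f g : trig_poly f -> trig_poly g -> trig_poly (fun x => f x + g x)
| trig_scale c f : trig_poly f -> trig_poly (fun x => c * f x).

Lemma trig_cst c : trig_poly (fun=> c).
Proof.
suff -> : (fun=> c) = (fun x => c * cosn 0 x) by exact/trig_scale/trig_cos.
by apply/funext => x; rewrite /cosn mulr0 mul0r cos0 mulr1.
Qed.

Lemma trig_sub f g : trig_poly f -> trig_poly g ->
  trig_poly (fun x => f x - g x).
Proof.
move=> tf tg; suff -> : (fun x => f x - g x) = (fun x => f x + -1 * g x).
  exact/trig_add/trig_scale.
by apply/funext => x; rewrite mulN1r.
Qed.

Lemma cosnD k m x : cosn (k + m) x = cosn k x * cosn m x - sinn k x * sinn m x.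
Proof. by rewrite /cosn natrD mulrDr mulrDl cosD. Qed.

Lemma sinnD k m x : sinn (k + m) x = sinn k x * cosn m x + cosn k x * sinn m x.
Proof. by rewrite /sinn natrD mulrDr mulrDl sinD. Qed.

Lemma cosnB k m x : (m <= k)%N ->
  cosn (k - m) x = cosn k x * cosn m x + sinn k x * sinn m x.
Proof. by move=> mk; rewrite /cosn natrB// mulrBr mulrBl cosB. Qed.

Lemma sinnB k m x : (m <= k)%N ->
  sinn (k - m) x = sinn k x * cosn m x - cosn k x * sinn m x.
Proof. by move=> mk; rewrite /sinn natrB// mulrBr mulrBl sinB. Qed.

Lemma cosnM k m x : (m <= k)%N ->
  cosn k x * cosn m x = 2^-1 * (cosn (k - m) x + cosn (k + m) x).
Proof. by move=> mk; rewrite cosnD cosnB//; field. Qed.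

Lemma sinnM k m x : (m <= k)%N ->
  sinn k x * sinn m x = 2^-1 * (cosn (k - m) x - cosn (k + m) x).
Proof. by move=> mk; rewrite cosnD cosnB//; field. Qed.

Lemma sinn_cosn k m x : (m <= k)%N ->
  sinn k x * cosn m x = 2^-1 * (sinn (k - m) x + sinn (k + m) x).
Proof. by move=> mk; rewrite sinnD sinnB//; field. Qed.

Lemma cosn_sinn k m x : (m <= k)%N ->
  cosn k x * sinn m x = 2^-1 * (sinn (k + m) x - sinn (k - m) x).
Proof. by move=> mk; rewrite sinnD sinnB//; field. Qed.

Lemma trig_mul f g : trig_poly f -> trig_poly g ->
  trig_poly (fun x => f x * g x).
Proof.
move=> tf; elim: tf g => [k|k|f1 f2 _ IH1 _ IH2|c f1 _ IH] g; last 2 first.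
- move=> tg; under eq_fun do rewrite mulrDl.
  by apply: trig_add; [exact: IH1|exact: IH2].
- move=> tg; under eq_fun do rewrite -mulrA.
  exact/trig_scale/IH.
- elim=> [m|m|g1 g2 _ H1 _ H2|c g1 _ H].
  + wlog mk : k m / (m <= k)%N => [hw|].
      have [|/ltnW] := leqP m k; first exact: hw.
      by move=> /hw; under eq_fun do rewrite mulrC.
    under eq_fun do rewrite cosnM//.
    by apply/trig_scale/trig_add; exact: trig_cos.
  + have [mk|/ltnW km] := leqP m k.
      under eq_fun do rewrite cosn_sinn//.
      by apply/trig_scale/trig_sub; exact: trig_sin.
    under eq_fun do rewrite mulrC sinn_cosn//.
    by apply/trig_scale/trig_add; exact: trig_sin.
  + by under eq_fun do rewrite mulrDr; exact: trig_add.
  + by under eq_fun do rewrite mulrCA; exact: trig_scale.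
- elim=> [m|m|g1 g2 _ H1 _ H2|c g1 _ H].
  + have [mk|/ltnW km] := leqP m k.
      under eq_fun do rewrite sinn_cosn//.
      by apply/trig_scale/trig_add; exact: trig_sin.
    under eq_fun do rewrite mulrC cosn_sinn//.
    by apply/trig_scale/trig_sub; exact: trig_sin.
  + wlog mk : k m / (m <= k)%N => [hw|].
      have [|/ltnW] := leqP m k; first exact: hw.
      by move=> /hw; under eq_fun do rewrite mulrC.
    under eq_fun do rewrite sinnM//.
    by apply/trig_scale/trig_sub; exact: trig_cos.
  + by under eq_fun do rewrite mulrDr; exact: trig_add.
  + by under eq_fun do rewrite mulrCA; exact: trig_scale.
Qed.

Lemma trig_exp f n : trig_poly f -> trig_poly (fun x => f x ^+ n).
Proof.
move=> tf; elim: n => [|n IH]; first exact: trig_cst.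
by under eq_fun do rewrite exprS; exact: trig_mul.
Qed.

Lemma continuous_sinn k : continuous (sinn k).
Proof.
move=> x; apply: (continuous_comp _ (@continuous_sin R _)).
exact: mulrl_continuous.
Qed.

Lemma continuous_cosn k : continuous (cosn k).
Proof.
move=> x; apply: (continuous_comp _ (@continuous_cos R _)).
exact: mulrl_continuous.
Qed.

Lemma trig_measurable f : trig_poly f ->
  measurable_fun setT (f : measurableTypeR R -> measurableTypeR R).
Proof.
elim=> [k|k|g h _ mg _ mh|c g _ mg].
- apply: continuous_measurable_fun; exact: continuous_cosn.
- apply: continuous_measurable_fun; exact: continuous_sinn.
- exact: measurable_funD.
- exact: measurable_funM.
Qed.

Lemma trig_bounded f : trig_poly f -> exists M, forall x, `|f x| <= M.
Proof.
elim=> [k|k|g h _ [M gM] _ [N hN]|c g _ [M gM]].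
- by exists 1 => x; exact: cos_max.
- by exists 1 => x; exact: sin_max.
- exists (M + N) => x; apply: (le_trans (ler_normD _ _)).
  exact: lerD (gM x) (hN x).
- by exists (`|c| * M) => x; rewrite normrM ler_wpM2l.
Qed.

End trigonometric_polynomials.

(** * Integration against a difference of finite measures *)

Section signed_integral.
Variable R : realType.
Local Notation bR := (measurableTypeR R).
Variables (mu1 mu2 : {finite_measure set bR -> \bar R}).

(** The charge mu1 - mu2, seen as a functional; a Jordan decomposition is the
    case of interest. *)
Definition diff_integral (f : R -> R) : R :=
  \int[mu1]_x f x - \int[mu2]_x f x.
Local Notation I := diff_integral.

Lemma trig_integrable (mu : {finite_measure set bR -> \bar R}) f :
  trig_poly f -> mu.-integrable setT (EFin \o f).
Proof.
move=> tf; apply: measurable_bounded_integrable => //.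
- by rewrite -ge0_fin_numE//; exact: fin_num_measure.
- exact: trig_measurable.
- have [M fM] := trig_bounded tf; exists M; split; first exact: num_real.
  by move=> y My x _; exact: le_trans (fM x) (ltW My).
Qed.

Lemma diff_integralD f g : trig_poly f -> trig_poly g ->
  I (fun x => f x + g x) = I f + I g.
Proof.
move=> tf tg; rewrite /I !RintegralD//; try exact: trig_integrable.
by rewrite addrACA opprD.
Qed.

Lemma diff_integralZ c f : trig_poly f -> I (fun x => c * f x) = c * I f.
Proof.
move=> tf; rewrite /I !RintegralZl//; try exact: trig_integrable.
by rewrite mulrBr.
Qed.

Lemma diff_integralB f g : trig_poly f -> trig_poly g ->
  I (fun x => f x - g x) = I f - I g.
Proof.
move=> tf tg.
rewrite (_ : (fun x => _) = (fun x => f x + -1 * g x)); last first.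
  by apply/funext => x; rewrite mulN1r.
rewrite diff_integralD//; last exact: trig_scale.
by rewrite diff_integralZ// mulN1r.
Qed.

Lemma Rintegral_le_on_support (mu : {finite_measure set bR -> \bar R})
    (E : set bR) f K : measurable E -> mu (~` E) = 0%E -> trig_poly f ->
  (forall x, E x -> `|f x| <= K) ->
  `|\int[mu]_x f x| <= K * fine (mu setT).
Proof.
move=> mE muE tf fK.
have iE g : mu.-integrable setT (EFin \o g) ->
    (\int[mu]_x g x = \int[mu]_(x in E) g x)%R.
  move=> ig; rewrite /Rintegral (@negligible_integral _ _ _ _ _ (~` E))//.
    by rewrite setTD setCK.
  exact: measurableC.
have itf := trig_integrable mu tf.
have itfE : mu.-integrable E (EFin \o f) by exact: integrableS itf.
have cE : mu.-integrable E (EFin \o cst K).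
  apply: (integrableS measurableT) => //.
  exact/trig_integrable/trig_cst.
rewrite iE//; apply: (le_trans (le_normr_Rintegral _ _)) => //.
apply: (@le_trans _ _ (\int[mu]_(x in E) K)).
  by apply: le_Rintegral => //; exact: integrable_norm.
rewrite -iE; last exact/trig_integrable/trig_cst.
by rewrite Rintegral_cst.
Qed.

End signed_integral.

(** * Charges on an avoiding set with Fourier coefficients tending to 0 *)

(** The orbit of x under multiplication by q avoids the open half circle
    (-1, 0). The condition for n = 0 already forces x to be in [0, 1]. *)
Definition avoiding_set (R : realType) (q : nat) : set R :=
  [set x : R | circle x /\ forall n, 0 <= sinn (q ^ n) x].

Section rajchman_charge.
Variable R : realType.
Local Notation bR := (measurableTypeR R).
Variables (mu1 mu2 : {finite_measure set bR -> \bar R}).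
Local Notation I := (diff_integral mu1 mu2).
Hypothesis Icos0 : I (@cosn R n) @[n --> \oo] --> 0.
Hypothesis Isin0 : I (@sinn R n) @[n --> \oo] --> 0.

Lemma cvg_half_shifts (u v : R^nat) k c :
  u @ \oo --> 0 -> v @ \oo --> 0 ->
  2^-1 * (u (n - k)%N + c * v (n + k)%N) @[n --> \oo] --> 0.
Proof.
move=> u0 v0.
have -> : 0 = 2^-1 * (0 + c * 0) :> R by rewrite mulr0 addr0 mulr0.
apply: cvgMl_tmp; apply: cvgD.
  exact: (cvg_comp (subn^~ k) u (cvg_subnr k) u0).
by apply: cvgMl_tmp; exact: (cvg_comp (addn^~ k) v (cvg_addnr k) v0).
Qed.

(** Multiplying by cos (pi n x) or sin (pi n x) shifts the spectrum of g by n,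
    by the product-to-sum formulas, so the coefficients of the charge that
    contribute are eventually arbitrarily far out. *)
Lemma trig_riemann_lebesgue g : trig_poly g ->
  I (fun x => g x * cosn n x) @[n --> \oo] --> 0 /\
  I (fun x => g x * sinn n x) @[n --> \oo] --> 0.
Proof.
elim=> [k|k|g1 g2 t1 [c1 s1] t2 [c2 s2]|c g1 t1 [c1 s1]].
- split.
  + apply: cvg_trans (cvg_half_shifts k 1 Icos0 Icos0).
    apply: near_eq_cvg; near=> n.
    have kn : (k <= n)%N by near: n; exact: nbhs_infty_ge.
    under eq_fun do rewrite mulrC cosnM//.
    rewrite diff_integralZ ?diff_integralD ?mul1r//; try exact: trig_cos.
    by apply: trig_add; exact: trig_cos.
  + apply: cvg_trans (cvg_half_shifts k 1 Isin0 Isin0).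
    apply: near_eq_cvg; near=> n.
    have kn : (k <= n)%N by near: n; exact: nbhs_infty_ge.
    under eq_fun do rewrite mulrC sinn_cosn//.
    rewrite diff_integralZ ?diff_integralD ?mul1r//; try exact: trig_sin.
    by apply: trig_add; exact: trig_sin.
- split.
  + rewrite -(oppr0 R).
    apply: cvg_trans (cvgN (cvg_half_shifts k (-1) Isin0 Isin0)).
    apply: near_eq_cvg; near=> n.
    have kn : (k <= n)%N by near: n; exact: nbhs_infty_ge.
    rewrite fctE; under eq_fun do rewrite mulrC cosn_sinn//.
    rewrite diff_integralZ ?diff_integralB; try exact: trig_sin.
      by rewrite -mulrN opprD mulN1r opprK addrC.
    by apply: trig_sub; exact: trig_sin.
  + apply: cvg_trans (cvg_half_shifts k (-1) Icos0 Icos0).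
    apply: near_eq_cvg; near=> n.
    have kn : (k <= n)%N by near: n; exact: nbhs_infty_ge.
    under eq_fun do rewrite mulrC sinnM//.
    rewrite diff_integralZ ?diff_integralB ?mulN1r//; try exact: trig_cos.
    by apply: trig_sub; exact: trig_cos.
- split.
  + rewrite -(addr0 0); apply: cvg_trans (cvgD c1 c2).
    apply: near_eq_cvg; near=> n; rewrite fctE -diff_integralD.
    * by congr I; apply/funext => x; rewrite mulrDl.
    * exact/trig_mul/trig_cos.
    * exact/trig_mul/trig_cos.
  + rewrite -(addr0 0); apply: cvg_trans (cvgD s1 s2).
    apply: near_eq_cvg; near=> n; rewrite fctE -diff_integralD.
    * by congr I; apply/funext => x; rewrite mulrDl.
    * exact/trig_mul/trig_sin.
    * exact/trig_mul/trig_sin.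
- split.
  + rewrite -(mulr0 c); apply: cvg_trans (cvgMl_tmp c1).
    apply: near_eq_cvg; near=> n; rewrite /= -diff_integralZ.
    * by congr I; apply/funext => x; rewrite mulrA.
    * exact/trig_mul/trig_cos.
  + rewrite -(mulr0 c); apply: cvg_trans (cvgMl_tmp s1).
    apply: near_eq_cvg; near=> n; rewrite /= -diff_integralZ.
    * by congr I; apply/funext => x; rewrite mulrA.
    * exact/trig_mul/trig_sin.
Unshelve. all: by end_near. Qed.

Variable q : nat.
Hypothesis q1 : (1 < q)%N.
Let E : set bR := avoiding_set q.
Hypotheses (mE : measurable E).
Hypotheses (E1 : mu1 (~` E) = 0%E) (E2 : mu2 (~` E) = 0%E).

(** P(sin (pi q^n x)) with P(t) = 3/4 - t/2 + t^2/2: its mean value over the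
    circle is 1, but it is at most 3/4 in absolute value on the avoiding set. *)
Let damper n (x : R) : R :=
  3 / 4 - sinn (q ^ n) x / 2 + sinn (q ^ n) x ^+ 2 / 2.

Lemma damperE n x :
  damper n x = 1 - 2^-1 * sinn (q ^ n) x - 4^-1 * cosn (2 * q ^ n) x.
Proof.
rewrite mul2n -addnn cosnD /damper.
have := cos2Dsin2 (pi * (q ^ n)%:R * x).
rewrite -/(cosn _ _) -/(sinn _ _) => cs.
have -> : cosn (q ^ n) x * cosn (q ^ n) x = 1 - sinn (q ^ n) x ^+ 2.
  by rewrite -cs expr2; ring.
by field.
Qed.

Lemma trig_damper n : trig_poly (damper n).
Proof.
rewrite (_ : damper n =
  (fun x => 1 - 2^-1 * sinn (q ^ n) x - 4^-1 * cosn (2 * q ^ n) x)).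
  by apply: trig_sub; [apply: trig_sub; [exact: trig_cst|]|]; apply: trig_scale;
    [exact: trig_sin|exact: trig_cos].
by apply/funext => x; rewrite damperE.
Qed.

Lemma damper_le n x : E x -> `|damper n x| <= 3 / 4.
Proof.
move=> [_ /(_ n) s0]; have := sin_le1 (pi * (q ^ n)%:R * x).
rewrite -/(sinn _ _) /damper => s1; rewrite ler_norml; apply/andP; split; nra.
Qed.

Lemma cvg_exp_infty : (fun n => q ^ n)%N @ \oo --> \oo.
Proof.
move=> A [N _ NA]; exists N => // n /= Nn; apply: NA => /=.
exact: leq_trans Nn (ltnW (ltn_expl n q1)).
Qed.

Lemma cvg_damper g : trig_poly g ->
  I (fun x => g x * damper n x) @[n --> \oo] --> I g.
Proof.
move=> tg; have [c0 s0] := trig_riemann_lebesgue tg.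
have {}s0 : I (fun x => g x * sinn (q ^ n)%N x) @[n --> \oo] --> 0.
  exact: cvg_comp cvg_exp_infty s0.
have {}c0 : I (fun x => g x * cosn (2 * q ^ n)%N x) @[n --> \oo] --> 0.
  apply: cvg_comp c0 => A [N _ NA]; exists N => // n /= Nn; apply: NA => /=.
  rewrite mul2n -addnn (leq_trans Nn)//.
  by rewrite (leq_trans (ltnW (ltn_expl n q1)))// leq_addr.
have -> : I g = I g - 2^-1 * 0 - 4^-1 * 0 by rewrite !mulr0 !subr0.
have lim : I g - 2^-1 * I (fun x => g x * sinn (q ^ n)%N x)
    - 4^-1 * I (fun x => g x * cosn (2 * q ^ n)%N x) @[n --> \oo]
    --> I g - 2^-1 * 0 - 4^-1 * 0.
  apply: cvgB; last exact: cvgMl_tmp.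
  by apply: cvgB; [exact: cvg_cst|exact: cvgMl_tmp].
apply: cvg_trans lim; apply: near_eq_cvg; near=> n.
have ts := trig_mul tg (trig_sin _ (q ^ n)).
have tc := trig_mul tg (trig_cos _ (2 * q ^ n)).
have ts' := trig_scale 2^-1 ts; have tc' := trig_scale 4^-1 tc.
rewrite -!diff_integralZ// -!diff_integralB//; last exact: trig_sub.
by congr I; apply/funext => x; rewrite damperE; ring.
Unshelve. all: by end_near. Qed.

(** In the limit n to infinity, multiplying g by the n-th damper keeps its
    integral but replaces its bound K on E by (3/4) K. *)
Lemma diff_integral_decay m g K :
  trig_poly g -> (forall x, E x -> `|g x| <= K) ->
  `|I g| <= (fine (mu1 setT) + fine (mu2 setT)) * ((3 / 4) ^+ m * K).
Proof.
elim: m g K => [|m IH] g K tg gK.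
  rewrite expr0 mul1r mulrC mulrDr; apply: le_trans (ler_normB _ _) _.
  by apply: lerD; apply: (Rintegral_le_on_support mE).
apply: cvgr_to_le (cvg_norm (cvg_damper tg)) _; apply: nearW => n.
rewrite exprSr -mulrA; apply: IH; first exact/trig_mul/trig_damper.
move=> x Ex; rewrite normrM mulrC.
by apply: ler_pM => //; [exact: damper_le|exact: gK].
Qed.

Lemma diff_integral_eq0 g : trig_poly g -> I g = 0.
Proof.
move=> tg; have [K gK] := trig_bounded tg.
apply/normr0_eq0/le_anti/andP; split => //.
have h : (fine (mu1 setT) + fine (mu2 setT)) * ((3 / 4) ^+ m * K)
    @[m --> \oo] --> 0.
  have -> : 0 = (fine (mu1 setT) + fine (mu2 setT)) * (0 * K) :> R.
    by rewrite mul0r mulr0.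
  apply: cvgMl_tmp; apply: cvgMr_tmp.
  have z1 : `|3 / 4 : R| < 1 by rewrite ger0_norm; lra.
  exact: cvg_expr z1.
apply: cvgr_to_ge h _; apply: nearW => m.
by apply: diff_integral_decay => // x _; exact: gK.
Qed.

End rajchman_charge.

(** * Polynomial approximation of a step function *)

Section threshold.
Variable R : realType.

Lemma bernoulli (x : R) n : -1 <= x -> 1 + n%:R * x <= (1 + x) ^+ n.
Proof.
move=> x1; elim: n => [|n IH]; first by rewrite mul0r addr0 expr0.
have x1' : 0 <= 1 + x by lra.
rewrite exprSr; apply: le_trans (ler_wpM2r x1' IH).
have : 0 <= n%:R * (x * x) by rewrite mulr_ge0// -expr2 sqr_ge0.
by rewrite -natr1; nra.
Qed.

(** Writing r = s^2, the factor n s^n stays bounded because (1 - s) n s^n is at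
    most the telescoping sum (1 - s) (1 + s + ... + s^(n-1)) <= 1, and the other
    factor s^n tends to 0. *)
Lemma cvg_natmul_expr (r : R) : 0 <= r < 1 -> n%:R * r ^+ n @[n --> \oo] --> 0.
Proof.
move=> /andP[r0 r1]; set s := Num.sqrt r.
have s0 : 0 <= s by exact: sqrtr_ge0.
have s1 : s < 1 by rewrite -sqrtr1 ltr_sqrt// ltr01.
have sn n : (1 - s) * (n%:R * s ^+ n) <= 1.
  have -> : n%:R * s ^+ n = \sum_(i < n) s ^+ n.
    by rewrite sumr_const card_ord mulr_natl.
  apply: (@le_trans _ _ (1 - s ^+ n)); last by rewrite gerBl exprn_ge0.
  rewrite -(opprB (s ^+ n)) subrX1 -mulNr opprB.
  rewrite ler_wpM2l// ?subr_ge0 ?(ltW s1)//; apply: ler_sum => i _.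
  by apply: ler_wiXn2l => //; [exact: ltW|exact: ltnW].
have z1 : `|s| < 1 by rewrite ger0_norm.
have : (1 - s)^-1 * s ^+ n @[n --> \oo] --> (1 - s)^-1 * 0.
  by apply: cvgMl_tmp; exact: cvg_expr z1.
rewrite mulr0 => h; apply: (squeeze_cvgr _ (cvg_cst 0) h).
apply: nearW => n; rewrite mulr_ge0 ?exprn_ge0//=.
rewrite -[r]sqr_sqrtr// -/s -exprM mulnC exprM expr2 mulrA.
rewrite ler_wpM2r ?exprn_ge0//.
by rewrite -[leRHS]mul1r ler_pdivlMr ?subr_gt0// mulrC.
Qed.

(** The exponent n 2^n is chosen so that n 2^n u^n tends to 0 for u < 1/2 and to
    infinity for u >= 1/2; the extra factor n is what decides the case u = 1/2,
    where (1 - u^n)^(2^n) would tend to 1/e. *)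
Definition threshold (n : nat) (u : R) : R := (1 - u ^+ n) ^+ (n * 2 ^ n).

Lemma threshold_bounded n u : 0 <= u <= 1 -> 0 <= threshold n u <= 1.
Proof.
move=> /andP[u0 u1]; have un1 : u ^+ n <= 1 by exact: exprn_ile1.
have un0 : 0 <= u ^+ n by exact: exprn_ge0.
by apply/andP; split; [apply: exprn_ge0|apply: exprn_ile1]; lra.
Qed.

Lemma threshold_cvg (u : R) : 0 <= u <= 1 ->
  threshold n u @[n --> \oo] --> ((u < 2^-1)%R%:R : R).
Proof.
move=> u01; have /andP[u0 u1] := u01.
have un1 n : u ^+ n <= 1 by exact: exprn_ile1.
have un0 n : 0 <= u ^+ n by exact: exprn_ge0.
case: ltP => /= [u2|u2].
  (* by Bernoulli's inequality, 1 - n (2 u)^n <= threshold n u <= 1 *)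
  have h : 1 - n%:R * (2 * u) ^+ n @[n --> \oo] --> (1 - 0 : R).
    by apply: cvgB; [exact: cvg_cst|apply: cvg_natmul_expr; lra].
  rewrite subr0 in h; apply: (squeeze_cvgr _ h (cvg_cst (1 : R))).
  apply: nearW => n; have /andP[_ ->] := threshold_bounded n u01.
  rewrite andbT; have := @bernoulli (- u ^+ n) (n * 2 ^ n); rewrite lerN2.
  move=> /(_ (un1 n)); rewrite natrM natrX mulrN.
  by rewrite exprMn mulrA.
(* (1 - v)^N (1 + v)^N <= 1 and (1 + v)^N >= 1 + N v >= 1 + n for v = u^n *)
apply: (squeeze_cvgr _ (cvg_cst 0) (@cvg_harmonic R)).
apply: nearW => n; have /andP[-> _] := threshold_bounded n u01 => /=.
set N := (n * 2 ^ n)%N.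
have n1 : n.+1%:R <= (1 + u ^+ n) ^+ N.
  apply: (le_trans _ (@bernoulli (u ^+ n) N _)); last exact: le_trans (un0 n).
  rewrite -natr1 addrC lerD2l natrM natrX -mulrA -exprMn.
  rewrite ler_peMr// exprn_ege1//; lra.
rewrite /harmonic/= -[leRHS]mul1r ler_pdivlMr// /threshold -/N.
apply: (@le_trans _ _ ((1 - u ^+ n) ^+ N * (1 + u ^+ n) ^+ N)).
  by rewrite ler_wpM2l// exprn_ge0// subr_ge0.
rewrite -exprMn exprn_ile1//.
  by rewrite mulr_ge0// ?subr_ge0// addr_ge0.
by have := un0 n; have := un1 n; nra.
Qed.

End threshold.

(** * Uniqueness of measures on half of the circle *)

Section uniqueness.
Variable R : realType.
Local Notation bR := (measurableTypeR R).

Lemma Rintegral_cvg_indic (mu : {finite_measure set bR -> \bar R})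
    (f : nat -> bR -> R) (A : set bR) : measurable A ->
  (forall n, trig_poly (f n)) -> (forall n x, `|f n x| <= 1) ->
  (forall x, f n x @[n --> \oo] --> (\1_A x : R)) ->
  \int[mu]_x (f n x) @[n --> \oo] --> fine (mu A).
Proof.
move=> mA tf f1 fA.
have [] := @dominated_convergence _ _ _ mu setT measurableT
  (fun n => EFin \o f n) (EFin \o \1_A) (EFin \o cst 1).
- by move=> n; apply/measurable_EFinP; exact: trig_measurable.
- exact/measurable_EFinP/measurable_indic.
- by apply/aeW => x _; apply: cvg_EFin (fA x); exact: nearW.
- exact/trig_integrable/trig_cst.
- by apply/aeW => x n _; rewrite lee_fin.
move=> _ _; rewrite integral_indic// setIT.
by move=> h; apply: fine_cvg; rewrite fineK//; exact: fin_num_measure.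
Qed.

Variables (mu1 mu2 : {finite_measure set bR -> \bar R}).
Hypotheses (supp1 : mu1 (~` `[0, 1]%classic) = 0%E).
Hypotheses (supp2 : mu2 (~` `[0, 1]%classic) = 0%E).
Hypothesis trig_eq0 : forall g, trig_poly g -> diff_integral mu1 mu2 g = 0.

Let fin_eq (mu nu : {finite_measure set bR -> \bar R}) A : measurable A ->
  fine (mu A) = fine (nu A) -> mu A = nu A.
Proof.
by move=> mA h; rewrite -[LHS]fineK -1?[RHS]fineK ?h//; exact: fin_num_measure.
Qed.

Lemma eq_on_total : mu1 setT = mu2 setT.
Proof.
apply: fin_eq => //; have := trig_eq0 (trig_cst 1).
rewrite /diff_integral !Rintegral_cst// !mul1r => /eqP.
by rewrite subr_eq0 => /eqP.
Qed.

Let measurable_cosn_lt (c : R) : measurable [set x : bR | cosn 1 x < c].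
Proof.
rewrite (_ : mkset _ = cosn 1 @^-1` `]-oo, c[); last first.
  by apply/seteqP; split => x; rewrite /= in_itv.
by rewrite -[_ @^-1` _]setTI; exact: (trig_measurable (trig_cos _ 1)).
Qed.

Lemma eq_on_cos_sublevel c : -1 <= c <= 1 ->
  let A := [set x : bR | cosn 1 x < c] in mu1 A = mu2 A.
Proof.
move=> c1 A.
have mA : measurable A by exact: measurable_cosn_lt.
apply: fin_eq => //.
(* u maps onto a part of [0, 1] and cosn 1 x < c means u x < 1/2 *)
pose u x : R := 4^-1 * ((2 - c) + cosn 1 x).
have u01 x : 0 <= u x <= 1.
  have := cos_geN1 (pi * 1%:R * x); have := cos_le1 (pi * 1%:R * x).
  by rewrite -/(cosn 1 x) /u; lra.
have tu : trig_poly u.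
  by apply/trig_scale/trig_add; [exact: trig_cst|exact: trig_cos].
pose f n x := threshold n (u x).
have tf n : trig_poly (f n).
  by apply/trig_exp/trig_sub; [exact: trig_cst|exact: trig_exp].
have f1 n x : `|f n x| <= 1.
  by have /andP[? ?] := threshold_bounded n (u01 x); rewrite ger0_norm.
have fA x : f n x @[n --> \oo] --> (\1_A x : R).
  have := threshold_cvg (u01 x).
  suff -> : (u x < 2^-1) = (x \in A) by rewrite indicE.
  apply/idP/idP => [ux|]; first by rewrite inE /A/=; move: ux; rewrite /u; lra.
  by rewrite inE /A/= /u; lra.
have h1 := @Rintegral_cvg_indic mu1 f A mA tf f1 fA.
have h2 := @Rintegral_cvg_indic mu2 f A mA tf f1 fA.
apply: (cvg_unique _ h1); first exact: norm_hausdorff.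
apply: cvg_trans h2; apply: near_eq_cvg; apply: nearW => n.
by have /eqP := trig_eq0 (tf n); rewrite subr_eq0 => /eqP.
Qed.

Let supported_eq (mu : {finite_measure set bR -> \bar R}) (A B : set bR) :
  measurable A -> measurable B -> mu (~` `[0, 1]%classic) = 0%E ->
  A `&` `[0, 1] = B `&` `[0, 1] -> mu A = mu B.
Proof.
move=> mA mB mu0 AB; have mC : measurable (~` `[0, 1]%classic : set bR).
  exact: measurableC.
have restrict C : measurable C -> mu C = mu (C `&` `[0, 1]).
  move=> mC'; rewrite (measureDI mu mC' (measurable_itv `[0, 1])).
  rewrite [X in (X + _)%E](_ : _ = 0%E) ?add0e//.
  by apply: (subset_measure0 _ mC _ mu0); [exact: measurableD|exact: subIsetr].
by rewrite restrict// AB -restrict.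
Qed.

Lemma eq_on_ray (a : R) : mu1 `]a, +oo[%classic = mu2 `]a, +oo[%classic.
Proof.
have [a0|a0] := ltP a 0.
  have h : `]a, +oo[%classic `&` `[0, 1]%classic = setT `&` `[0, 1]%classic.
    rewrite setTI; apply/seteqP; split => x /=; rewrite !in_itv/= ?andbT.
      by case.
    by move=> x01; split => //; lra.
  rewrite (@supported_eq mu1 _ setT)// (@supported_eq mu2 _ setT)//.
  exact: eq_on_total.
have [a1|a1] := leP 1 a.
  have h : `]a, +oo[%classic `&` `[0, 1]%classic = set0 `&` `[0, 1]%classic.
    rewrite set0I; apply/seteqP; split => x //=; rewrite !in_itv/= ?andbT.
    by move=> -[]; lra.
  rewrite (@supported_eq mu1 _ set0)// (@supported_eq mu2 _ set0)//.
  by rewrite !measure0.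
have pi0 := pi_gt0 R.
have h : `]a, +oo[%classic `&` `[0, 1]%classic =
    [set x | cosn 1 x < cos (pi * a)] `&` `[0, 1]%classic.
  apply/seteqP; split => x /=; rewrite !in_itv/= ?andbT /cosn mulr1.
    move=> [ax x01]; split => //.
    by rewrite ltr_cos ?in_itv/= ?ltr_pM2l// ?mulr_ge0 ?ler_piMr//; lra.
  move=> [cxa x01]; split => //; move: cxa.
  by rewrite ltr_cos ?in_itv/= ?ltr_pM2l// ?mulr_ge0 ?ler_piMr//; lra.
have mA := measurable_cosn_lt (cos (pi * a)).
rewrite (supported_eq _ mA supp1 h)// (supported_eq _ mA supp2 h)//.
by apply: eq_on_cos_sublevel; rewrite cos_geN1 cos_le1.
Qed.

(** Half of the circle suffices to parametrize the rays by sublevel sets of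
    cos (pi x), which is decreasing there; the rays form a pi-system generating
    the Borel sets. *)
Lemma trig_determines_measure A : measurable A -> mu1 A = mu2 A.
Proof.
move=> mA.
have covered : \bigcup_k `](- k%:R : R), +oo[%classic = setT :> set R.
  apply/seteqP; split => // x _; exists (Num.bound `|x|) => //=.
  rewrite in_itv/= andbT ltrNl; apply: le_lt_trans (archi_boundP (normr_ge0 x)).
  by rewrite -normrN ler_norm.
have mG : (@measurable _ bR) = <<s @RGenOInfty.G R >>.
  exact: RGenOInfty.measurableE.
have Gi : setI_closed (@RGenOInfty.G R).
  move=> _ _ [x ->] [y ->]; exists (Num.max x y).
  by apply/seteqP; split => z; rewrite /= !in_itv/= !andbT gt_max => /andP.
have Gg i : @RGenOInfty.G R `](- i%:R : R), +oo[%classic by exists (- i%:R).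
have eqG B : @RGenOInfty.G R B -> mu1 B = mu2 B.
  by move=> [a ->]; exact: eq_on_ray.
have fin i : (mu1 `](- i%:R : R)%R, +oo[%classic < +oo)%E.
  by rewrite -ge0_fin_numE//; exact: fin_num_measure.
exact: (measure_unique _ _ mG Gi Gg covered mu1 mu2 eqG fin A mA).
Qed.

End uniqueness.

(** * Topology of the avoiding sets *)

Section avoiding_set_closed.
Variable R : realType.

Lemma sinn_periodic m (x : R) (k : int) : sinn m (x + 2 * k%:~R) = sinn m x.
Proof.
have posk (y : R) (n : nat) : sinn m (y + 2 * n%:R) = sinn m y.
  rewrite /sinn (_ : _ * (y + _) = pi * m%:R * y + pi *+ 2 *+ (m * n)).
    exact: (periodicn (@sinD2pi R)).
  by rewrite -[_ *+ (m * n)]mulr_natr -[pi *+ 2]mulr_natr natrM; ring.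
case: k => n; first exact: posk.
rewrite NegzE mulrNz; have := posk (x + 2 * - n.+1%:R) n.+1.
by rewrite -addrA -mulrDr addNr mulr0 addr0 => ->.
Qed.

Lemma avoiding_set_circle q : avoiding_set q `<=` @circle R.
Proof. by move=> x []. Qed.

Lemma avoiding_set_itv q : avoiding_set q `<=` (`[0, 1]%classic : set R).
Proof.
move=> x [+ /(_ 0%N)]; rewrite /circle/= !in_itv/= => /andP[x1 ->].
rewrite andbT expn0 /sinn mulr1 => s0; rewrite leNgt; apply/negP => x0.
have pi0 := pi_gt0 R.
have : 0 < sin (- (pi * x)) by apply: sin_gt0_pi; nra.
by rewrite sinN; lra.
Qed.

Lemma avoiding_periodization q :
  [set x : R | exists k : int, avoiding_set q (x + 2 * k%:~R)] =
  [set x | forall n, 0 <= sinn (q ^ n) x].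
Proof.
apply/seteqP; split => x /=.
  by move=> [k [_ h]] n; have := h n; rewrite sinn_periodic.
move=> h; exists (Num.floor ((1 - x) / 2)); split => [|n]; last first.
  by rewrite sinn_periodic.
have := floor_le_tmp ((1 - x) / 2); have := floorD1_gt ((1 - x) / 2).
by rewrite /circle/= in_itv/= intrD; lra.
Qed.

Lemma closed_sinn_ge0 q : closed [set x : R | forall n, 0 <= sinn (q ^ n) x].
Proof.
rewrite (_ : mkset _ = \bigcap_n (sinn (q ^ n) @^-1` [set y : R | 0 <= y])).
  apply: closed_bigI => n _; apply: closed_comp; last exact: closed_ge.
  by move=> x _; exact: continuous_sinn.
by apply/seteqP; split => x /= h n; have := h n => // /(_ I).
Qed.

Lemma avoiding_set_closed q : circle_closed (avoiding_set q : set R).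
Proof.
split; first exact: avoiding_set_circle.
by rewrite avoiding_periodization; exact: closed_sinn_ge0.
Qed.

Lemma avoiding_set_measurable q :
  measurable (avoiding_set q : set (measurableTypeR R)).
Proof.
rewrite (_ : avoiding_set q =
  @circle R `&` [set x | forall n, 0 <= sinn (q ^ n) x])//.
apply: measurableI; first exact: measurable_itv.
by apply: closed_measurable; exact: closed_sinn_ge0.
Qed.

End avoiding_set_closed.

(** * Fourier coefficients of the real and imaginary parts *)

Section fourier_parts.
Variable R : realType.
Local Notation bR := (measurableTypeR R).
Local Open Scope complex_scope.

Lemma ler_normc_Re (z : R[i]) (e : R) : `|z| < e%:C -> `|complex.Re z| < e.
Proof.
by move=> ze; rewrite -ltcR; apply: le_lt_trans ze; exact: normc_ge_Re.
Qed.

Lemma ler_normc_Im (z : R[i]) (e : R) : `|z| < e%:C -> `|complex.Im z| < e.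
Proof.
rewrite normc_def ltcR; apply: le_lt_trans.
by rewrite -sqrtr_sqr ler_wsqrtr// lerDr sqr_ge0.
Qed.

Lemma charge_integralN (nu : {charge set bR -> \bar R}) g : trig_poly g ->
  charge_integral nu (fun x => - g x) = - charge_integral nu g.
Proof.
move=> tg; rewrite -mulN1r; under eq_fun do rewrite -mulN1r.
exact: diff_integralZ.
Qed.

Variable mu : complex_measure R.
Let Cr k := charge_integral (cre mu) (cosn k).
Let Sr k := charge_integral (cre mu) (sinn k).
Let Ci k := charge_integral (cim mu) (cosn k).
Let Si k := charge_integral (cim mu) (sinn k).

Lemma half_complex : 2^-1 = (2^-1)%:C :> R[i].
Proof. by rewrite fmorphV rmorph_nat. Qed.

Lemma fourier_coef_nat (k : nat) :
  fourier_coef mu k%:Z = (2^-1 * (Cr k - Si k)) +i* (2^-1 * (Sr k + Ci k)).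
Proof.
rewrite /fourier_coef half_complex; simpc.
by congr (_ +i* _); congr (_ * (_ + _)).
Qed.

Lemma fourier_coef_opp (k : nat) :
  fourier_coef mu (- k%:Z) = (2^-1 * (Cr k + Si k)) +i* (2^-1 * (Ci k - Sr k)).
Proof.
rewrite /fourier_coef half_complex /cintegral/= mulrNz.
have -> : (fun x : R => cos (pi * - k%:R * x)) = cosn k.
  by apply/funext => x; rewrite mulrN mulNr cosN.
have -> : (fun x : R => sin (pi * - k%:R * x)) = (fun x => - sinn k x).
  by apply/funext => x; rewrite mulrN mulNr sinN.
rewrite !(charge_integralN _ (trig_sin _ k)) opprK.
by simpc; congr (_ +i* _); rewrite addrC.
Qed.

Hypothesis vanish : forall e : R, 0 < e -> exists N : nat,
  forall n : int, (N <= `|n|)%N -> `|fourier_coef mu n| < e%:C.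

(** The cosine and sine coefficients of both parts of mu are linear combinations
    of the real and imaginary parts of the coefficients of mu at k and -k. *)
Lemma charge_fourier_cvg0 :
  [/\ Cr n @[n --> \oo] --> 0, Sr n @[n --> \oo] --> 0,
      Ci n @[n --> \oo] --> 0 & Si n @[n --> \oo] --> 0].
Proof.
have small e : 0 < e -> exists N, forall k, (N <= k)%N ->
    [/\ `|Cr k| < e, `|Sr k| < e, `|Ci k| < e & `|Si k| < e].
  move=> e0; have [N Ne] := vanish (divr_gt0 e0 (ltr0n R 2)).
  exists N => k Nk; have := Ne k%:Z Nk.
  have := Ne (- k%:Z); rewrite abszN => /(_ Nk).
  rewrite fourier_coef_nat fourier_coef_opp.
  move=> /[dup] /ler_normc_Re/= + /ler_normc_Im/=.
  rewrite !ltr_norml => /andP[a1 a2] /andP[a3 a4].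
  move=> /[dup] /ler_normc_Re/= + /ler_normc_Im/=.
  rewrite !ltr_norml => /andP[a5 a6] /andP[a7 a8].
  by split; lra.
by split; apply/cvgrPdist_lt => e /small[N Ne]; exists N => // k /= /Ne[*];
  rewrite sub0r normrN.
Qed.

End fourier_parts.

(** * Parisian sets *)

Section parisian.
Variable R : realType.
Local Notation bR := (measurableTypeR R).

Lemma jordan_pos_null (nu : {charge set bR -> \bar R}) (P N : set bR)
    (nuPN : hahn_decomposition nu P N) (A : set bR) :
  measurable A -> nu.-null_set A -> jordan_pos nuPN A = 0%E.
Proof.
move=> mA nuA; rewrite jordan_posE cjordan_posE /crestr0 mem_set// /crestr/=.
have mP : measurable P by case: nuPN => -[].
by apply: nuA; [exact: measurableI|exact: subIsetl].
Qed.

Lemma jordan_neg_null (nu : {charge set bR -> \bar R}) (P N : set bR)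
    (nuPN : hahn_decomposition nu P N) (A : set bR) :
  measurable A -> nu.-null_set A -> jordan_neg nuPN A = 0%E.
Proof.
move=> mA nuA; rewrite jordan_negE cjordan_negE /crestr0 mem_set// /crestr/=.
have mN : measurable N by case: nuPN => _ [].
by rewrite nuA ?oppe0//; exact: measurableI.
Qed.

Lemma rajchman_charge_eq0 (q : nat) (nu : {charge set bR -> \bar R}) :
    (1 < q)%N -> nu.-null_set (~` avoiding_set q) ->
    charge_integral nu (cosn n) @[n --> \oo] --> 0 ->
    charge_integral nu (sinn n) @[n --> \oo] --> 0 ->
  forall A, measurable A -> nu A = 0%E.
Proof.
move=> q1 suppnu; rewrite /charge_integral.
move: (projT2 (cid (projT2 (cid (Hahn_decomposition nu))))) => nuPN c0 s0 A mA.
have mE := @avoiding_set_measurable R q; have mCE := measurableC mE.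
have P0 := jordan_pos_null nuPN mCE suppnu.
have N0 := jordan_neg_null nuPN mCE suppnu.
have trig0 := @diff_integral_eq0 R (jordan_pos nuPN) (jordan_neg nuPN)
  c0 s0 q q1 mE P0 N0.
have m01 : measurable (~` `[0, 1]%classic : set bR) by exact: measurableC.
have sub01 : ~` `[0, 1]%classic `<=` ~` (avoiding_set q : set R).
  exact/subsetC/avoiding_set_itv.
have P01 := subset_measure0 m01 mCE sub01 P0.
have N01 := subset_measure0 m01 mCE sub01 N0.
rewrite (jordan_decomp nuPN mA) /cadd/= cscaleN1.
rewrite (trig_determines_measure P01 N01 trig0 mA) subee//.
exact: fin_num_measure.
Qed.

(** A measure is its own test case for the Rajchman property of its spectrum,
    since its coefficients vanish identically off the spectrum. *)
Lemma avoiding_set_parisian q : (1 < q)%N -> parisian (avoiding_set q : set R).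
Proof.
move=> q1; split; first exact: avoiding_set_closed.
move=> mu [suppr suppi] nac rajmu; apply: nac.
have sub : ~` @circle R `<=` ~` avoiding_set q.
  exact/subsetC/avoiding_set_circle.
have circ : supported_on (@circle R) mu.
  by split; [exact: subset_null_set suppr|exact: subset_null_set suppi].
have off : vanishes_along (~` fourier_supp mu) (fourier_coef mu).
  move=> e e0; exists 0%N => n + _; rewrite /fourier_supp/= => /negP.
  by rewrite negbK => /eqP ->; rewrite normr0 ltcR.
have on := rajmu mu circ off.
have all e : 0 < e -> exists N : nat,
    forall n : int, (N <= `|n|)%N -> `|fourier_coef mu n| < e%:C%C.
  move=> e0; have [N1 h1] := on e e0; have [N2 h2] := off e e0.
  exists (maxn N1 N2) => n; rewrite geq_max => /andP[n1 n2].
  by have [/h1|/h2] := pselect (fourier_supp mu n); exact.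
have [cr sr ci si] := charge_fourier_cvg0 all.
split=> A _ B mB _; first exact: rajchman_charge_eq0 q1 suppr cr sr _ mB.
exact: rajchman_charge_eq0 q1 suppi ci si _ mB.
Qed.

End parisian.

(** * A parametrization of the avoiding set with Hoelder inverse *)

Section digit_map.
Variables (R : realType) (b : nat).
Hypothesis b2 : (1 < b)%N.
Local Notation q := (2 * b)%N.

Definition digit_term (y : R) (k : nat) : R :=
  (Num.truncn (b%:R ^+ k * y))%:R / q%:R ^+ k.

(** Up to the factor 2, this replaces base b by base 2b in the expansion of y:
    if y in [0, 1) has the base-b digits d_1, d_2, ..., then floor(b^k y) = d_k + b
    floor(b^(k-1) y), and summation by parts gives digit_map y = 2 sum_k d_k /
    (2b)^k. The form with floors makes monotonicity evident. *)
Definition digit_map (y : R) : R := limn (series (digit_term y)).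

Let b_gt0 : 0 < b%:R :> R. Proof. by rewrite ltr0n; lia. Qed.
Let q_gt0 : 0 < q%:R :> R. Proof. by rewrite ltr0n; lia. Qed.
Let bqV : b%:R / q%:R = 2^-1 :> R.
Proof. by rewrite natrM invfM mulrCA divff ?mulr1// gt_eqF. Qed.

Lemma truncn_natDr (y : R) n : 0 <= y ->
  Num.truncn (y + n%:R) = (Num.truncn y + n)%N.
Proof.
move=> y0; apply/eqP; rewrite truncn_eq ?addr_ge0//.
have /andP[h1 h2] := truncn_itv y0.
by rewrite -addSn !natrD lerD2r ltrD2r h1.
Qed.

Lemma digit_termS y k : digit_term y k.+1 = q%:R^-1 * digit_term (b%:R * y) k.
Proof.
rewrite /digit_term [q%:R ^+ _]exprS exprSr -[_ * b%:R * y]mulrA.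
by rewrite invfM mulrCA.
Qed.

Lemma digit_term_bounds y k : 0 <= y -> 0 <= digit_term y k <= y * 2^-1 ^+ k.
Proof.
move=> y0; rewrite /digit_term divr_ge0 ?exprn_ge0//=.
rewrite -bqV expr_div_n mulrA ler_wpM2r ?invr_ge0 ?exprn_ge0//.
have : 0 <= b%:R ^+ k * y by rewrite mulr_ge0 ?exprn_ge0.
by rewrite mulrC => /truncn_itv/andP[].
Qed.

Let half_lt1 : `|2^-1 : R| < 1.
Proof. by rewrite ger0_norm//; lra. Qed.

Let cvg_half (y : R) : series (geometric y 2^-1) @ \oo --> 2 * y.
Proof.
have -> : 2 * y = y * (1 - 2^-1)^-1.
  by rewrite mulrC; congr (_ * _); rewrite -[LHS]invrK; congr (_^-1); lra.
exact: cvg_geometric_series.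
Qed.

Lemma digit_series_cvg y : 0 <= y ->
  series (digit_term y) @ \oo --> digit_map y.
Proof.
move=> y0; suff : cvgn (series (digit_term y)) by [].
apply: (@series_le_cvg _ _ (geometric y 2^-1)) => [k|k|k|].
- by have /andP[] := digit_term_bounds k y0.
- by rewrite /geometric/= mulr_ge0 ?exprn_ge0.
- by have /andP[] := digit_term_bounds k y0.
- exact: is_cvg_geometric_series.
Qed.

Lemma digit_mapDn y n : 0 <= y -> digit_map (y + n%:R) = digit_map y + 2 * n%:R.
Proof.
move=> y0; have yn0 : 0 <= y + n%:R by rewrite addr_ge0.
apply: (cvg_unique _ (digit_series_cvg yn0)); first exact: norm_hausdorff.
rewrite [X in X @ _](_ : _ =
    series (digit_term y) + series (geometric n%:R 2^-1)).
  by apply: cvgD; [exact: digit_series_cvg|exact: cvg_half].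
rewrite -seriesD; congr series; apply/funext => k; rewrite fctE /digit_term.
rewrite mulrDr -natrX -[in X in _ + X]natrM truncn_natDr ?mulr_ge0//.
rewrite natrD mulrDl.
congr (_ + _); rewrite /geometric/= natrM natrX mulrAC -bqV expr_div_n mulrC.
by rewrite mulrA.
Qed.

Lemma digit_map_scale y : 0 <= y ->
  q%:R * digit_map y = digit_map (b%:R * y) + q%:R * (Num.truncn y)%:R.
Proof.
move=> y0; have by0 : 0 <= b%:R * y by rewrite mulr_ge0.
have h : [sequence series (digit_term y) n.+1]_n @ \oo --> digit_map y.
  by rewrite cvg_shiftS; exact: digit_series_cvg.
have {}h : q%:R * series (digit_term y) n.+1 @[n --> \oo]
    --> q%:R * digit_map y.
  exact: cvgMl_tmp.
apply: (cvg_unique _ h); first exact: norm_hausdorff.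
rewrite [X in X @ _](_ : _ =
    (fun n => series (digit_term (b%:R * y)) n + q%:R * (Num.truncn y)%:R)).
  by apply: cvgD; [exact: digit_series_cvg|exact: cvg_cst].
apply/funext => n; rewrite /series/= big_nat_recl// mulrDr addrC; congr (_ + _).
  rewrite big_distrr/=; apply: eq_bigr => k _.
  by rewrite digit_termS mulrA divff ?mul1r// gt_eqF.
by rewrite /digit_term !expr0 mul1r divr1.
Qed.

Lemma digit_map_ge0 y : 0 <= y -> 0 <= digit_map y.
Proof.
move=> y0; apply: cvgr_to_ge (digit_series_cvg y0) _; apply: nearW => n.
by apply: sumr_ge0 => k _; have /andP[] := digit_term_bounds k y0.
Qed.

Lemma digit_map_le_double y : 0 <= y -> digit_map y <= 2 * y.
Proof.
move=> y0; apply: ler_cvg_to (digit_series_cvg y0) (@cvg_half y) _.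
apply: nearW => n.
by apply: ler_sum => k _; have /andP[] := digit_term_bounds k y0.
Qed.

Lemma digit_map_itv y : 0 <= y < 1 -> 0 <= digit_map y <= 1.
Proof.
move=> /andP[y0 y1]; rewrite digit_map_ge0//=.
have := digit_map_scale y0.
have -> : Num.truncn y = 0%N by apply/eqP; rewrite truncn_eq// y0.
rewrite mulr0 addr0 => h.
have : q%:R * digit_map y <= q%:R * y.
  rewrite h natrM -mulrA; apply: digit_map_le_double.
  by rewrite mulr_ge0.
by rewrite ler_pM2l// => /le_trans; apply; exact: ltW.
Qed.

(** Modulo 2, multiplication by 2b on the values corresponds to multiplication
    by b on the parameters. *)
Lemma digit_map_iter n y : 0 <= y ->
  exists j : nat,
    q%:R ^+ n * digit_map y = digit_map (b%:R ^+ n * y) + 2 * j%:R.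
Proof.
elim: n y => [|n IH] y y0.
  by exists 0%N; rewrite !expr0 !mul1r mulr0 addr0.
have by0 : 0 <= b%:R * y by rewrite mulr_ge0.
have [j hj] := IH _ by0.
exists (j + q ^ n * b * Num.truncn y)%N.
rewrite exprSr -mulrA digit_map_scale// mulrDr hj exprSr -!mulrA -addrA.
have -> : (j + q ^ n * b * Num.truncn y)%:R =
    j%:R + q%:R ^+ n * b%:R * (Num.truncn y)%:R :> R.
  by rewrite natrD [X in _ + X = _]natrM [X in _ + X * _ = _]natrM natrX.
by congr (_ + _); rewrite !natrM; ring.
Qed.

Lemma digit_map_avoiding y : 0 <= y < 1 -> avoiding_set q (digit_map y).
Proof.
move=> y01; have /andP[y0 y1] := y01; have /andP[g0 g1] := digit_map_itv y01.
split; first by rewrite /circle/= in_itv/=; lra.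
move=> n; have [j hj] := digit_map_iter n y0.
set z := b%:R ^+ n * y in hj.
have z0 : 0 <= z by rewrite mulr_ge0 ?exprn_ge0.
have /andP[t1 t2] := truncn_itv z0.
have w01 : 0 <= z - (Num.truncn z)%:R < 1.
  by rewrite subr_ge0 t1/= ltrBlDr addrC natr1.
have zw : digit_map z =
    digit_map (z - (Num.truncn z)%:R) + 2 * (Num.truncn z)%:R.
  by rewrite -digit_mapDn ?subrK//; case/andP: w01.
rewrite (_ : sinn _ _ = sinn 1 (q%:R ^+ n * digit_map y)); last first.
  by rewrite /sinn mulr1 natrX mulrA.
rewrite hj zw -addrA -mulrDr -natrD (sinn_periodic _ _ (_ + _)%N).
have /andP[w0 w1] := digit_map_itv w01; have := pi_gt0 R.
by rewrite /sinn mulr1 => pi0; apply: sin_ge0_pi; nra.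
Qed.

(** All the terms of the series are monotone in y, and the term of index n grows
    by (2b)^-n at least when b^n y grows by 1. *)
Lemma digit_map_separation n (x y : R) : 0 <= x -> 1 <= b%:R ^+ n * (y - x) ->
  q%:R ^- n <= digit_map y - digit_map x.
Proof.
move=> x0 bxy; have xy : x <= y.
  by rewrite -subr_ge0 -(pmulr_rge0 _ (exprn_gt0 n b_gt0)); lra.
have y0 := le_trans x0 xy.
have mono k : digit_term x k <= digit_term y k.
  rewrite ler_wpM2r ?invr_ge0 ?exprn_ge0// ler_nat le_truncn//.
  by rewrite ler_wpM2l ?exprn_ge0.
apply: cvgr_to_ge (cvgB (digit_series_cvg y0) (digit_series_cvg x0)) _.
exists n.+1 => // m /= nm.
rewrite !fctE /series/= -sumrB big_mkord (bigD1 (Ordinal nm))//=.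
apply: (@le_trans _ _ (digit_term y n - digit_term x n)); last first.
  by rewrite lerDl sumr_ge0// => k _; rewrite subr_ge0.
rewrite /digit_term -mulrBl -[leLHS]mul1r ler_wpM2r ?invr_ge0 ?exprn_ge0//.
rewrite lerBrDl natr1 ler_nat -addn1 -truncn_natDr ?mulr_ge0 ?exprn_ge0//.
by rewrite le_truncn// -lerBrDl -mulrBr.
Qed.

(** For the least n with b^n |x - y| >= 1, |x - y| is at most b b^-n, hence at
    most b ((2b)^-n)^s, and [digit_map_separation] bounds (2b)^-n. *)
Lemma digit_map_holder (s x y : R) : 0 < s -> q%:R `^ s <= b%:R ->
  0 <= x < 1 -> 0 <= y < 1 ->
  `|x - y| <= b%:R * `|digit_map x - digit_map y| `^ s.
Proof.
move=> s0 qsb; wlog : x y / x < y => [hw|xy] x01 y01.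
  have [xy|yx|->] := ltgtP x y; first exact: hw.
    by rewrite distrC [X in _ * X `^ _]distrC; exact: hw.
  by rewrite subrr normr0 mulr_ge0// powR_ge0.
have d0 : 0 < y - x by rewrite subr_gt0.
have ex : exists n, 1 <= b%:R ^+ n * (y - x).
  exists (Num.bound (y - x)^-1).
  have dV : 0 <= (y - x)^-1 by rewrite invr_ge0 ltW.
  rewrite -ler_pdivrMr// div1r; apply: le_trans (ltW (archi_boundP dV)) _.
  by rewrite -natrX ler_nat ltnW// ltn_expl.
case: (ex_minnP ex) => -[|n] bn minn; first by lra.
have bn' : b%:R ^+ n * (y - x) < 1.
  by rewrite ltNge; apply/negP => /minn; rewrite ltnn.
have x0 : 0 <= x by case/andP: x01.
have sep := digit_map_separation x0 bn.
rewrite distrC ger0_norm ?(ltW d0)// distrC.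
rewrite [X in X `^ s]ger0_norm; last first.
  by apply: le_trans sep; rewrite invr_ge0 exprn_ge0.
apply: (@le_trans _ _ (b%:R * (q%:R ^- n.+1) `^ s)); last first.
  by rewrite ler_wpM2l// ge0_ler_powR// ?nnegrE ?(ltW s0)//
    ?invr_ge0 ?exprn_ge0//
    (le_trans _ sep)// invr_ge0 exprn_ge0.
have -> : (q%:R ^- n.+1) `^ s = (q%:R `^ s) ^- n.+1.
  by rewrite -(powR_invn _ (ltW q_gt0)) powRAC powR_invn ?powR_ge0.
apply: (@le_trans _ _ (b%:R * b%:R ^- n.+1)).
  by rewrite exprS invfM mulrA divff ?gt_eqF// mul1r -[leRHS]mul1r ler_pdivlMr
    ?exprn_gt0// mulrC ltW.
rewrite ler_wpM2l// lef_pV2 ?posrE ?exprn_gt0// ?powR_gt0//.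
by rewrite lerXn2r ?nnegrE ?powR_ge0.
Qed.

End digit_map.

(** * Hausdorff dimension of the avoiding sets *)

Section dimension.
Variable R : realType.

(** Two points of [0, 1] are at distance at most 1, half of the period, so that
    no translate by a period brings them closer. *)
Lemma circle_dist_ge (x y : R) : 0 <= x <= 1 -> 0 <= y <= 1 ->
  `|x - y| <= circle_dist x y.
Proof.
move=> x01 y01; apply: lb_le_inf; first by exists `|x - y + 2 * 0%:~R|, 0.
move=> _ [k _ <-]; have [->|k0] := eqVneq k 0; first by rewrite mulr0 addr0.
have : 1 <= `|k%:~R : R|.
  by rewrite -intr_norm (ler_int _ 1) -gtz0_ge1 normr_gt0.
move=> k1; have := ler_normB (x - y + 2 * k%:~R) (x - y).
rewrite addrAC subrr add0r normrM (ger0_norm (ler0n R 2)) => tri.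
have : `|x - y| <= 1 by rewrite ler_norml; lra.
lra.
Qed.

Lemma circle_diam_ge0 (U : set R) : (0 <= circle_diam U)%E.
Proof. by rewrite /circle_diam le_max lexx. Qed.

Lemma circle_dist_le_diam (U : set R) x y : U x -> U y ->
  ((circle_dist x y)%:E <= circle_diam U)%E.
Proof.
move=> Ux Uy; rewrite /circle_diam le_max; apply/orP; right.
by apply: ereal_sup_ubound; exists x => //; exists y.
Qed.

(** The parameters mapped into F k lie in an interval of length 2 b d_k^s, with
    d_k the diameter of F k, by [digit_map_holder]. As F covers the avoiding
    set, these intervals cover [0, 1), so their lengths add up to 1 at least. *)
Lemma hausdorff_premeasure_avoiding (b : nat) (s delta : R) :
  (1 < b)%N -> 0 < s ->
  (2 * b)%:R `^ s <= (b%:R : R) ->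
  (((2 * b)%:R^-1)%:E <= hausdorff_premeasure s delta (avoiding_set (2 * b)))%E.
Proof.
move=> b1 s0 bs; apply/ereal_infP => _ [F [_ Fd EF] <-].
have b0 : 0 < b%:R :> R by rewrite ltr0n; exact: ltnW.
have q0 : 0 < (2 * b)%:R :> R by rewrite ltr0n muln_gt0 /= ltnW.
pose d k := fine (circle_diam (F k)).
have dE k : circle_diam (F k) = (d k)%:E.
  rewrite fineK// ge0_fin_numE ?circle_diam_ge0//.
  exact: le_lt_trans (Fd k) (ltry _).
have d_ge0 k : 0 <= d k by rewrite -lee_fin -dE circle_diam_ge0.
pose V k := [set y : R | 0 <= y < 1 /\ F k (digit_map b y)].
pose L k := b%:R * d k `^ s.
have L_ge0 k : 0 <= L k by rewrite mulr_ge0 ?powR_ge0.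
pose c k := xget 0 (V k).
pose J k : set (measurableTypeR R) := `[c k - L k, c k + L k]%classic.
have VJ k : V k `<=` J k.
  move=> y Vy; have [c01 Fc] : V k (c k) := xgetPex 0 (ex_intro _ y Vy).
  have [y01 Fy] := Vy.
  suff : `|y - c k| <= L k by rewrite /J/= in_itv/= ler_norml; lra.
  apply: le_trans (digit_map_holder b1 s0 bs y01 c01) _.
  rewrite ler_wpM2l ?(ltW b0)// ge0_ler_powR ?nnegrE ?(ltW s0)//.
  have := circle_dist_ge (digit_map_itv b1 y01) (digit_map_itv b1 c01).
  move=> /le_trans; apply.
  by rewrite -lee_fin -dE; exact: circle_dist_le_diam.
have cover : `[0, 1[%classic `<=` \bigcup_k J k.
  move=> y; rewrite /= in_itv/= => y01.
  have [k _ Fk] := EF _ (digit_map_avoiding b1 y01).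
  by exists k => //; exact: VJ.
have lenJ k : (lebesgue_measure (J k) =
    (2 * b)%:R%:E * (poweR (circle_diam (F k)) s))%E.
  rewrite dE poweR_EFin -EFinM natrM -mulrA -/(L k).
  rewrite lebesgue_measure_itv/= lte_fin.
  case: ifPn => [_|]; first by rewrite -EFinB; congr (_%:E); ring.
  by rewrite -leNgt => h; congr (_%:E); have := L_ge0 k; lra.
have : (@lebesgue_measure R `[0%R, 1%R[%classic <=
    \sum_(0 <= k <oo) lebesgue_measure (J k))%E.
  by apply: measure_sigma_subadditive => // k; exact: measurable_itv.
rewrite lebesgue_measure_itv/= lte01 oppr0 adde0.
under eq_eseriesr do rewrite lenJ.
rewrite nneseriesZl; last by move=> k _; exact: poweR_ge0.
by rewrite -lee_pdivrMl// mule1.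
Qed.

Lemma hausdorff_dim_avoiding (b : nat) (alpha : R) : (1 < b)%N ->
  (forall s, 0 < s < alpha -> (2 * b)%:R `^ s <= (b%:R : R)) ->
  (alpha%:E <= hausdorff_dim (avoiding_set (2 * b)))%E.
Proof.
move=> b1 bs; apply/ereal_infP => _ [s [s0 Hs] <-]; rewrite lee_fin leNgt.
apply/negP => sa.
have {}bs : (2 * b)%:R `^ s <= (b%:R : R) by apply: bs; rewrite s0.
have q0 : 0 < (2 * b)%:R^-1 :> R by rewrite invr_gt0 ltr0n muln_gt0 /= ltnW.
suff : (((2 * b)%:R^-1)%:E <=
    hausdorff_measure s (avoiding_set (2 * b) : set R))%E.
  by rewrite Hs lee_fin leNgt q0.
apply: le_trans (hausdorff_premeasure_avoiding 1 b1 s0 bs) _.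
by apply: ereal_sup_ubound; exists 1 => /=.
Qed.

End dimension.

Theorem theoremA (R : realType) (alpha : R) (halpha : (alpha < 1)%R) :
  exists E : set R, parisian E /\ (alpha%:E <= hausdorff_dim E)%E.
Proof.
(* j >= alpha / (1 - alpha), that is, alpha <= j / (j + 1) *)
pose j := (Num.bound `|alpha / (1 - alpha)|).+1.
have b1 : (1 < 2 ^ j)%N by rewrite -[1%N](expn0 2) ltn_exp2l.
exists (avoiding_set (2 * 2 ^ j)); split.
  by apply: avoiding_set_parisian; rewrite -expnS -[1%N](expn0 2) ltn_exp2l.
apply: hausdorff_dim_avoiding => // s /andP[s0 sa].
have aj : alpha <= j%:R * (1 - alpha).
  rewrite -ler_pdivrMr ?subr_gt0//; apply: le_trans (ler_norm _) _.
  apply: le_trans (ltW (archi_boundP (normr_ge0 _))) _.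
  by rewrite ler_nat.
rewrite -expnS !natrX -!powR_mulrn// -powRrM ler_powR ?ler1n//.
rewrite -natr1; have : 0 <= j%:R :> R by []. nra.
Qed.
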